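(* Let $F=F(X)$ be a free group with basis $X$, and let $H, K\leqslant F$ be two finitely generated subgroups. If at least one of $H$, $K$ is generated by a set of words that are positive with respect to $X$, then the pair $(H,K)$ satisfies the Hanna Neumann conjecture, i.e. $$\mathrm{rank}(H\cap K)-1\;\leqslant\;[\mathrm{rank}(H)-1]\,[\mathrm{rank}(K)-1].$$
   Context: A word (element) $w\in F(X)$ is positive with respect to the basis $X$ if its freely reduced form contains only symbols $x\in X$ and no symbol $x^{-1}$ with $x\in X$. The rank of a free group is the cardinality of a basis. The Hanna Neumann conjecture states that the displayed inequality holds for all finitely generated subgroups $H,K$ of a free group $F$.
   Formalization: The subgroups H and K are additionally assumed nontrivial; without this the displayed inequality fails, e.g. for H = 1 (generated by the empty set of positive words) and K of rank 3, where it would say -1 ≤ -2. *)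

(* Defs.v *)
From mathcomp Require Import all_boot all_order all_algebra.
From mathcomp Require Import boolp classical_sets cardinality constructive_ereal.

Set Implicit Arguments.
Unset Strict Implicit.
Unset Printing Implicit Defensive.

Local Open Scope group_scope.
Local Open Scope classical_set_scope.

Section FreeGroups.
Variable F : groupType.
Implicit Types (A B G P S X : set F) (w : seq (F * bool)) (g : F).

Definition subgroup A : Prop :=
  A 1 /\ forall x y, A x -> A y -> A (x / y).

Definition generated S : set F := smallest subgroup S.

Definition finitely_generated G : Prop :=
  exists2 S, finite_set S & G = generated S.

(* The letter (x, true) stands for the symbol x, and (x, false) for the
   symbol x^-1.  The latter is formal: reducedness is a property of the
   sequence of letters, not of their values in F. *)
Definition letter_val (l : F * bool) : F := if l.2 then l.1 else l.1^-1.

Definition word_val w : F := \prod_(l <- w) letter_val l.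

Definition word_on B w : Prop := forall l, l \in w -> B l.1.

Definition reduced w : bool :=
  sorted (fun l m => ~~ ((l.1 == m.1) && (l.2 != m.2))) w.

Definition basis G B : Prop :=
  G = generated B /\
  forall w, word_on B w -> reduced w -> w <> [::] -> word_val w <> 1.

Definition reduced_form X g w : Prop :=
  [/\ word_on X w, reduced w & word_val w = g].

Definition positive X g : Prop :=
  exists2 w, reduced_form X g w & forall l, l \in w -> l.2.

Definition positively_generated X G : Prop :=
  exists2 P, (forall g, P g -> positive X g) & G = generated P.

(* The number of elements of a basis of G, and +oo if G has no finite basis.
   The values are integers rather than naturals so that rank G - 1 is not
   truncated when G is trivial. *)
Definition rank G : \bar int :=
  xget +oo%E
    [set r | exists n B, [/\ basis G B, (B #= `I_n)%card & r = (n%:Z)%:E%E]].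

End FreeGroups.

(* Main.v *)
(* Stallings graphs are realised as finite subgraphs of Schreier graphs: F acts
   on the right translates of H, and reduced words generating H trace loops at
   the vertex H.  A spanning tree of a finite connected subgraph carrying H
   gives a basis of H of size E - V + 1.  The graph of H `&` K is the component
   of (H, K) in the fiber product of the graphs of H and K.

   If K is generated by positive words, then every vertex of its graph has
   out-degree and in-degree at least 1, and E_K - V_K is the sum over the
   vertices of (out - 1), and also that of (in - 1).  Once the hair of the graph
   of H is trimmed (which does not change E_H - V_H and cannot decrease E - V in
   the fiber product), a vertex of H of degrees (a, b) can be given weights
   alpha, beta >= 0 with alpha + beta = a + b - 2, so that a vertex of the fiber
   product above it and above a vertex of K of degrees (c, d) has total degree
   at most 2 + alpha (c - 1) + beta (d - 1).  Summing over all pairs of vertices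
   gives 2 (E - V) <= 2 (E_H - V_H) (E_K - V_K). *)

Require Import Defs.
From mathcomp Require Import all_boot all_order all_algebra.
From mathcomp Require Import boolp classical_sets cardinality constructive_ereal.
From mathcomp Require Import zify.

Import GRing.Theory.

Set Implicit Arguments.
Unset Strict Implicit.
Unset Printing Implicit Defensive.

(** * Free reduction *)

(** The condition of [reduced] over an arbitrary alphabet: below, words are formed both from
    elements of the group and from edges of a graph. *)
Definition freely_reduced (A : eqType) (w : seq (A * bool)) :=
  sorted (fun l m => ~~ ((l.1 == m.1) && (l.2 != m.2))) w.

Arguments freely_reduced : simpl never.

Section FreeReduction.
Variable A : eqType.
Implicit Types (l m : A * bool) (s w : seq (A * bool)).

Definition invl l : A * bool := (l.1, ~~ l.2).

Definition invw w := rev (map invl w).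

(** Left multiplication by a letter in the model of the free group by reduced words. *)
Definition push l s :=
  if s is m :: s' then if m == invl l then s' else l :: s else [:: l].

Definition reduce w := foldr push [::] w.

Lemma invlK : involutive invl.
Proof. by case=> a b; rewrite /invl /= negbK. Qed.

Lemma cancel_invl l m : (l.1 == m.1) && (l.2 != m.2) = (m == invl l).
Proof. by case: l m => [a []] [b []]; rewrite /invl /= xpair_eqE eq_sym. Qed.

Lemma freely_reduced_cons l m s :
  freely_reduced [:: l, m & s] = (m != invl l) && freely_reduced (m :: s).
Proof. by rewrite /freely_reduced /= cancel_invl. Qed.

Lemma freely_reduced_behead l s : freely_reduced (l :: s) -> freely_reduced s.
Proof. exact: path_sorted. Qed.

Lemma push_reduced l s : freely_reduced s -> freely_reduced (push l s).
Proof.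
case: s => [|m s] //= ms; case: ifPn => ml; first exact: freely_reduced_behead ms.
by rewrite freely_reduced_cons ml.
Qed.

Lemma reduce_reduced w : freely_reduced (reduce w).
Proof. by elim: w => //= l w; apply: push_reduced. Qed.

Lemma reduce_id w : freely_reduced w -> reduce w = w.
Proof.
elim: w => //= l [//|m w] IH; rewrite freely_reduced_cons => /andP[ml mw].
by rewrite (IH mw) /= (negbTE ml).
Qed.

(** Inverse letters act on reduced words by inverse maps, so [push] gives an action of the free
    group. This is what makes [reduce] compatible with concatenation and cancellation. *)
Lemma pushK l s : freely_reduced s -> push l (push (invl l) s) = s.
Proof.
case: s => [|m s] /=; first by rewrite eqxx.
rewrite invlK; case: eqVneq => [->|ml]; last by rewrite /= eqxx.
by case: s => [|n s] //; rewrite freely_reduced_cons => /andP[/negbTE /= ->].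
Qed.

Lemma reduce_catr u w : reduce (u ++ reduce w) = reduce (u ++ w).
Proof.
by rewrite /reduce !foldr_cat -!/(reduce _) (reduce_id (reduce_reduced w)).
Qed.

Lemma reduce_catl u w : reduce (reduce u ++ w) = reduce (u ++ w).
Proof.
elim: u => //= l u <-; case: (reduce u) => [//|m v] /=.
by case: eqP => // ->; rewrite pushK ?reduce_reduced.
Qed.

Lemma invw_cat u w : invw (u ++ w) = invw w ++ invw u.
Proof. by rewrite /invw map_cat rev_cat. Qed.

Lemma invw_cons l w : invw (l :: w) = rcons (invw w) (invl l).
Proof. by rewrite /invw /= rev_cons. Qed.

Lemma reduce_invw_cat w : reduce (invw w ++ w) = [::].
Proof.
elim: w => // l w IH; rewrite invw_cons cat_rcons -reduce_catr /=.
by rewrite -{2}(invlK l) pushK ?reduce_reduced // reduce_catr.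
Qed.

Lemma mem_invw l w : (l \in invw w) = (invl l \in w).
Proof. by rewrite mem_rev -{1}(invlK l) (mem_map (can_inj invlK)). Qed.

Lemma mem_push l s m : m \in push l s -> m \in l :: s.
Proof.
case: s => [//|n s] /=; case: ifP => // _ ms.
by rewrite !inE ms !orbT.
Qed.

Lemma mem_reduce w l : l \in reduce w -> l \in w.
Proof.
elim: w => //= m w IH /mem_push; rewrite !inE => /orP[->//|/IH ->].
by rewrite orbT.
Qed.

End FreeReduction.

(** * Evaluation of formal words in a group *)

Section Evaluation.
Local Open Scope group_scope.
Variables (F : groupType) (A : eqType).
Implicit Types (b : A -> F) (l : A * bool) (w : seq (A * bool)).

Definition evl b l : F := if l.2 then b l.1 else (b l.1)^-1.

Definition ev b w : F := \prod_(l <- w) evl b l.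

Lemma ev_nil b : ev b [::] = 1.
Proof. exact: big_nil. Qed.

Lemma ev_cons b l w : ev b (l :: w) = evl b l * ev b w.
Proof. exact: big_cons. Qed.

Lemma ev_cat b u w : ev b (u ++ w) = ev b u * ev b w.
Proof. exact: big_cat. Qed.

Lemma ev_rcons b l w : ev b (rcons w l) = ev b w * evl b l.
Proof. by rewrite -cats1 ev_cat ev_cons ev_nil mulg1. Qed.

Lemma evl_invl b l : evl b (invl l) = (evl b l)^-1.
Proof. by case: l => a []; rewrite /evl /= ?invgK. Qed.

Lemma ev_invw b w : ev b (invw w) = (ev b w)^-1.
Proof.
elim: w => [|l w IH]; first by rewrite ev_nil invg1.
by rewrite invw_cons ev_rcons IH evl_invl ev_cons invgM.
Qed.

Lemma ev_push b l w : ev b (push l w) = evl b l * ev b w.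
Proof.
case: w => [|m w] /=; first by rewrite ev_cons.
case: eqP => [->|_]; last by rewrite ev_cons.
by rewrite ev_cons evl_invl mulVKg.
Qed.

Lemma ev_reduce b w : ev b (reduce w) = ev b w.
Proof. by elim: w => //= l w IH; rewrite ev_push IH ev_cons. Qed.

End Evaluation.

(** * Generated subgroups and uniqueness of reduced forms *)

Section Subgroups.
Local Open Scope group_scope.
Local Open Scope classical_set_scope.
Variable F : groupType.
Implicit Types (G H S B X : set F) (w : seq (F * bool)).

Lemma word_valE w : word_val w = ev id w.
Proof. by []. Qed.

Lemma reducedE w : reduced w = freely_reduced w.
Proof. by []. Qed.

Lemma subgroup1 G : subgroup G -> G 1. Proof. by case. Qed.

Lemma subgroupV G x : subgroup G -> G x -> G x^-1.
Proof. by case=> G1 GD Gx; rewrite -[x^-1]mul1g; apply: GD. Qed.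

Lemma subgroupM G x y : subgroup G -> G x -> G y -> G (x * y).
Proof.
by move=> sG Gx Gy; rewrite -[y]invgK; apply: sG.2 => //; apply: subgroupV.
Qed.

Lemma subgroup_generated S : subgroup (generated S).
Proof.
split=> [M [sM _]|x y Sx Sy M MP]; first exact: subgroup1.
by apply: MP.1.2; [apply: Sx|apply: Sy].
Qed.

Lemma mem_generated S x : S x -> generated S x.
Proof. by move=> Sx M [_]; apply. Qed.

Lemma generated_min S G : subgroup G -> S `<=` G -> generated S `<=` G.
Proof. by move=> sG SG x; apply. Qed.

Lemma generated_mono S S' : S `<=` S' -> generated S `<=` generated S'.
Proof.
move=> SS'; apply: generated_min; first exact: subgroup_generated.
by move=> x /SS'; apply: mem_generated.
Qed.

Lemma subgroup_ev (A : eqType) (b : A -> F) G (w : seq (A * bool)) :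
  subgroup G -> (forall l, l \in w -> G (b l.1)) -> G (ev b w).
Proof.
move=> sG; elim: w => [|l w IH] Gw; first by rewrite ev_nil; apply: subgroup1.
rewrite ev_cons; apply: subgroupM => //; last first.
  by apply: IH => m mw; apply: Gw; rewrite inE mw orbT.
have Gl := Gw l (mem_head _ _).
by rewrite /evl; case: l.2 => //; apply: subgroupV.
Qed.

Lemma generatedP S x :
  generated S x <-> exists2 w, word_on S w & word_val w = x.
Proof.
split=> [|[w Sw <-]]; last first.
  apply: (subgroup_ev (b := id)) => [|l /Sw]; first exact: subgroup_generated.
  exact: mem_generated.
apply: (generated_min (G := [set x | exists2 w, word_on S w & word_val w = x])).
  split; first by exists [::] => //; rewrite word_valE ev_nil.
  move=> _ _ [u Su <-] [v Sv <-]; exists (u ++ invw v).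
    move=> l; rewrite mem_cat mem_invw => /orP[/Su //|/Sv]; by case: l.
  by rewrite word_valE ev_cat ev_invw.
move=> y Sy; exists [:: (y, true)]; first by move=> l; rewrite inE => /eqP ->.
by rewrite word_valE ev_cons ev_nil mulg1.
Qed.

Lemma basis_reduce G B w :
  basis G B -> word_on B w -> word_val w = 1 -> reduce w = [::].
Proof.
move=> [_ free] Bw w1; apply: contrapT => /(free _ _ _) []; rewrite ?reducedE.
- by move=> l /mem_reduce /Bw.
- exact: reduce_reduced.
- by rewrite word_valE ev_reduce.
Qed.

(** Write u as u w^-1 w: the factor u w^-1 has value 1, hence reduces to the empty word, which
    leaves the reduction of w. *)
Lemma basis_reduce_inj G B u w : basis G B -> word_on B u -> word_on B w ->
  word_val u = word_val w -> reduce u = reduce w.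
Proof.
move=> basB Bu Bw uw.
rewrite -[u]cats0 -(reduce_invw_cat w) reduce_catr catA -reduce_catl.
rewrite (basis_reduce (w := u ++ invw w) basB) // => [l|];
  last by rewrite word_valE ev_cat ev_invw -!word_valE uw mulgV.
by rewrite mem_cat mem_invw => /orP[/Bu|/Bw].
Qed.

(** Each of the finitely many given generators is a word in finitely many elements of P; these
    elements together generate G. *)
Lemma finitely_generated_sub G P :
  finitely_generated G -> G = generated P ->
  exists2 s : seq F, [set` s] `<=` P & G = generated [set` s].
Proof.
move=> [S /finite_seqP[t ->] GS] GP.
have lift (u : seq F) : [set` u] `<=` G ->
    exists2 s : seq F, [set` s] `<=` P & [set` u] `<=` generated [set` s].
  elim: u => [|x u IH] uG; first by exists [::].
  have [s sP us] : exists2 s : seq F, [set` s] `<=` P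
    & [set` u] `<=` generated [set` s].
    by apply: IH => y /= yu; apply: uG; rewrite /= inE yu orbT.
  have : G x by apply: uG; rewrite /= mem_head.
  rewrite GP => /generatedP[w Pw <-].
  exists (map fst w ++ s).
    by move=> y; rewrite /= mem_cat => /orP[/mapP[l /Pw ? ->]|/sP].
  move=> y; rewrite /= inE => /orP[/eqP -> |/us].
    apply/generatedP; exists w => // l lw.
    by rewrite /= mem_cat map_f.
  by apply: generated_mono => z /= zs; rewrite mem_cat zs orbT.
have [|s sP ts] := lift t; first by rewrite GS; apply: mem_generated.
exists s => //; apply/seteqP; split.
  by rewrite GS; apply: generated_min => //; apply: subgroup_generated.
by rewrite GP; apply: generated_mono.
Qed.

End Subgroups.
(** * Invariance of rank *)

Section Rank.
Local Open Scope group_scope.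
Local Open Scope classical_set_scope.
Variable F : groupType.
Implicit Types (G B : set F) (w : seq (F * bool)) (s : seq F).

Lemma card_uniq_seq s : uniq s -> ([set` s] #= `I_(size s))%card.
Proof.
move=> us; have -> : [set` s] = nth 1 s @` `I_(size s).
  apply/seteqP; split=> x /=; first by move/(nthP 1) => [i ? <-]; exists i.
  by move=> [i ? <-]; rewrite mem_nth.
apply: inj_card_eq => i j; rewrite !inE /= => si sj /eqP.
by rewrite nth_uniq // => /eqP.
Qed.

Lemma card_seqP B n :
  (B #= `I_n)%card -> exists s, [/\ uniq s, size s = n & B = [set` s]].
Proof.
move=> Bn; have /finite_seqP[t Bt] : finite_set B by apply/finite_setP; exists n.
have Bs : B = [set` undup t].
  by rewrite Bt; apply/seteqP; split=> x /=; rewrite mem_undup.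
exists (undup t); split=> //; first exact: undup_uniq.
have := card_uniq_seq (undup_uniq t); rewrite -Bs => /card_esym /card_eq_trans.
by move=> /(_ _ _ Bn) /card_eq_II.
Qed.

(** * Weighted exponent sums of words *)

Section ExponentSum.
Local Open Scope ring_scope.
Variables (A : eqType) (f : A -> rat).
Implicit Types u : seq (A * bool).

Definition expl (l : A * bool) : rat := if l.2 then f l.1 else - f l.1.

Definition expsum u : rat := \sum_(l <- u) expl l.

Lemma expl_invl l : expl (invl l) = - expl l.
Proof. by case: l => a []; rewrite /expl //= GRing.opprK. Qed.

Lemma expsum_cat u v : expsum (u ++ v) = expsum u + expsum v.
Proof. exact: big_cat. Qed.

Lemma expsum_invw u : expsum (invw u) = - expsum u.
Proof.
elim: u => [|l u IH]; first by rewrite /expsum !big_nil GRing.oppr0.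
rewrite invw_cons -cats1 expsum_cat IH /expsum !big_cons big_nil expl_invl.
by rewrite GRing.addr0 GRing.opprD GRing.addrC.
Qed.

Lemma expsum_reduce u : expsum (reduce u) = expsum u.
Proof.
elim: u => //= l u IH; rewrite [RHS]/expsum big_cons -/(expsum u) -IH.
case: (reduce u) => [|m v] /=; first by rewrite /expsum !big_cons !big_nil.
case: eqP => [->|_]; last by rewrite /expsum !big_cons.
by rewrite [in RHS]/expsum big_cons expl_invl GRing.addrA GRing.subrr GRing.add0r.
Qed.

End ExponentSum.

(** The universal property of a free group with target the additive group of rationals: the map is
    the exponent sum weighted by [f]. *)
Lemma basis_hom G B (f : F -> rat) : basis G B ->
  exists phi : F -> rat,
    (forall x y, G x -> G y -> phi (x / y)%g = phi x - phi y)%R /\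
    (forall b, B b -> phi b = f b).
Proof.
move=> basB; have [GB _] := basB.
(* A chosen word in B for each element of G; the default [[::]] is only taken outside G. *)
pose W g := xget [::] [set w | word_on B w /\ word_val w = g].
have WP g : G g -> word_on B (W g) /\ word_val (W g) = g.
  rewrite GB => /generatedP[w Bw wg]; rewrite /W; case: xgetP => //.
  by move=> /(_ w) [].
(* The sum depends only on the value of the word: the quotient of two words of equal value reduces
   to the empty word, and reduction preserves the sum. *)
have expW w : word_on B w -> expsum f w = expsum f (W (word_val w)).
  move=> Bw; have [|BW valW] := WP (word_val w); first by rewrite GB;
    apply/generatedP; exists w.
  apply/eqP; rewrite -GRing.subr_eq0 -expsum_invw -expsum_cat -expsum_reduce.
  rewrite (basis_reduce basB) ?/expsum ?big_nil //.
    by move=> l; rewrite mem_cat mem_invw => /orP[/Bw|/BW].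
  by rewrite word_valE ev_cat ev_invw -!word_valE valW mulgV.
exists (fun g => expsum f (W g)); split=> [x y Gx Gy|b Bb].
  have [Bx vx] := WP x Gx; have [By vy] := WP y Gy.
  rewrite -expsum_invw -expsum_cat [RHS]expW; last first.
    by move=> l; rewrite mem_cat mem_invw => /orP[/Bx|/By].
  by rewrite word_valE ev_cat ev_invw -!word_valE vx vy.
have vb : word_val [:: (b, true)] = b by rewrite word_valE ev_cons ev_nil mulg1.
rewrite -{1}vb -expW; first by rewrite /expsum big_cons big_nil GRing.addr0.
by move=> l; rewrite inE => /eqP ->.
Qed.

Local Open Scope ring_scope.

(** Linear algebra over the rationals: the homomorphisms dual to the basis [s] factor the identity
    matrix of size [size s] through a space of dimension [size t]. *)
Lemma basis_size_le G s t : uniq s ->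
  basis G [set` s] -> G = generated [set` t] ->
  (size s <= size t)%N.
Proof.
move=> us bas Gt.
have sG x : x \in s -> G x.
  by rewrite bas.1; exact: (@mem_generated _ [set` s]).
have tG x : x \in t -> G x.
  by rewrite Gt; exact: (@mem_generated _ [set` t]).
have sub : subgroup G by rewrite Gt; apply: subgroup_generated.
have /choice[phi phiP] (i : 'I_(size s)) :=
  basis_hom (fun x => (x == nth 1%g s i)%:R) bas.
have phiB i := (phiP i).1.
have phi1 i : phi i 1%g = 0.
  by rewrite -[1%g](mulgV 1%g) phiB ?subrr //; apply: subgroup1.
(* The coefficients [a] must serve all [i] at once, since they form a row of the left factor. *)
have coef x : G x -> exists a : 'rV[rat]_(size t),
    forall i, phi i x = \sum_j a 0 j * phi i (nth 1%g t j).
  (* Membership in G is carried through the induction because [phi i] is additive only on G. *)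
  move=> Gx; suff [] : G x /\ exists a : 'rV[rat]_(size t),
    forall i, phi i x = \sum_j a 0 j * phi i (nth 1%g t j) by [].
  move: (Gx); rewrite {1}Gt; apply: (@generated_min _ _ [set x | G x /\
    exists a : 'rV[rat]_(size t),
      forall i, phi i x = \sum_j a 0 j * phi i (nth 1%g t j)]).
    split=> [|y z [Gy [a ya]] [Gz [b zb]]].
      split; first exact: subgroup1.
      by exists 0 => i; rewrite phi1 big1 // => j _; rewrite mxE mul0r.
    split; first exact: sub.2.
    exists (a - b) => i; rewrite phiB // ya zb -sumrB; apply: eq_bigr => j _.
    by rewrite !mxE mulrBl.
  move=> y /= ty; split; first exact: tG.
  have jt : (index y t < size t)%N by rewrite index_mem.
  exists (delta_mx 0 (Ordinal jt)) => i; rewrite (bigD1 (Ordinal jt)) //= big1.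
    by rewrite mxE !eqxx mul1r addr0 nth_index.
  by move=> j /negbTE jn; rewrite mxE jn andbF mul0r.
have /choice[a aP] (k : 'I_(size s)) := coef _ (sG _ (mem_nth 1%g (ltn_ord k))).
apply: (@mulmx1_min _ _ _ (\matrix_(k, j) a k 0 j)
  (\matrix_(j, i) phi i (nth 1%g t j))).
apply/matrixP => k i; rewrite !mxE.
under eq_bigr do rewrite !mxE.
rewrite -aP (phiP i).2 ?nth_uniq //=; exact: mem_nth.
Qed.

Lemma rankE G s : uniq s -> basis G [set` s] -> rank G = ((size s)%:Z)%:E%E.
Proof.
move=> us bas; rewrite /rank; case: xgetP => [_ _ [n [B [basB cB ->]]]|/=].
  have [t [ut <- Bt]] := card_seqP cB; rewrite Bt in basB.
  congr (_%:Z%:E)%E; apply/eqP; rewrite eqn_leq.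
  by rewrite (basis_size_le ut basB bas.1) (basis_size_le us bas basB.1).
move=> /(_ ((size s)%:Z)%:E%E) []; exists (size s), [set` s]; split=> //.
exact: card_uniq_seq.
Qed.

End Rank.
(** * Schreier bases *)

Section FreeFamily.
Local Open Scope group_scope.
Local Open Scope classical_set_scope.
Variables (F : groupType) (A : eqType) (b : A -> F) (D : seq A).
Hypothesis free : forall u : seq (A * bool),
  (forall l, l \in u -> l.1 \in D) -> freely_reduced u -> u <> [::] ->
  ev b u <> 1.

Lemma free_family_inj : {in D &, injective b}.
Proof.
move=> x y Dx Dy bxy; apply: contrapT => xy.
apply: (@free [:: (x, true); (y, false)]) => //.
- by move=> l; rewrite !inE => /orP[] /eqP ->.
- by rewrite freely_reduced_cons /invl /= xpair_eqE eq_sym (introF eqP xy).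
- by rewrite !ev_cons ev_nil mulg1 /evl /= bxy mulgV.
Qed.

Lemma free_family_basis :
  basis (generated [set` [seq b x | x <- D]]) [set` [seq b x | x <- D]].
Proof.
split=> // w Dw redw wn0.
have [u Du wu] : exists2 u : seq (A * bool), (forall l, l \in u -> l.1 \in D)
    & w = [seq (b l.1, l.2) | l <- u].
  elim: w Dw {redw wn0} => [_|l w IH Dw]; first by exists [::].
  have [|u Du ->] := IH; first by move=> m mw; apply: Dw; rewrite inE mw orbT.
  have /= /mapP[x Dx lx] := Dw l (mem_head _ _).
  exists ((x, l.2) :: u) => [m|]; last by case: l lx {Dw} => /= ? ? ->.
  by rewrite inE => /orP[/eqP ->|/Du].
have -> : word_val w = ev b u by rewrite wu /word_val big_map.
apply: free => //; last by move=> u0; apply: wn0; rewrite wu u0.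
(* Cancelling indices have cancelling values, so a word reduced in the values is reduced in the
   indices. *)
move: redw; rewrite /reduced wu sorted_map; apply: sub_sorted => l m /=.
by apply: contra => /andP[/eqP -> ->]; rewrite eqxx.
Qed.

End FreeFamily.

(** * Paths in the Schreier graph of a right action *)

Section SchreierGraph.
Local Open Scope group_scope.
Local Open Scope classical_set_scope.
Variables (F : groupType) (Q : eqType) (act : Q -> F -> Q).
Hypothesis act1 : forall q, act q 1 = q.
Hypothesis actM : forall q g h, act q (g * h) = act (act q g) h.
Implicit Types (q : Q) (e : Q * F) (E T D : seq (Q * F)).
Implicit Types (l : F * bool) (w : seq (F * bool)).

(** A pair [(q, x)] is the edge labelled x from q to [act q x]. Reading the letter x^-1 crosses such
    an edge backwards, so [edge] returns the same pair for both directions. *)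
Definition tgt e := act e.1 e.2.
Definition edge q l : Q * F := (if l.2 then q else act q l.1^-1, l.1).
Definition step q l := act q (evl id l).
Definition dest q w := act q (ev id w).

Fixpoint trav q w :=
  if w is l :: w' then edge q l :: trav (step q l) w' else [::].

Definition reads E q w := all [in E] (trav q w).

Lemma actK q g : act (act q g) g^-1 = q.
Proof. by rewrite -actM mulgV act1. Qed.

Lemma actVK q g : act (act q g^-1) g = q.
Proof. by rewrite -actM mulVg act1. Qed.

Lemma step_invl q l : step (step q l) (invl l) = q.
Proof. by rewrite /step evl_invl actK. Qed.

Lemma edge_invl q l : edge (step q l) (invl l) = edge q l.
Proof. by case: l => x []; rewrite /edge /step /evl //= actK. Qed.

Lemma dest_cons q l w : dest q (l :: w) = dest (step q l) w.
Proof. by rewrite /dest ev_cons actM. Qed.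

Lemma dest_cat q u w : dest q (u ++ w) = dest (dest q u) w.
Proof. by rewrite /dest ev_cat actM. Qed.

Lemma dest_nil q : dest q [::] = q.
Proof. by rewrite /dest ev_nil act1. Qed.

Lemma dest_rcons q l w : dest q (rcons w l) = step (dest q w) l.
Proof. by rewrite -cats1 dest_cat dest_cons dest_nil. Qed.

Lemma dest_invw q w : dest (dest q w) (invw w) = q.
Proof. by rewrite /dest ev_invw actK. Qed.

Lemma trav_cat q u w : trav q (u ++ w) = trav q u ++ trav (dest q u) w.
Proof.
elim: u q => [|l u IH] q; first by rewrite dest_nil.
by rewrite /= IH dest_cons.
Qed.

Lemma trav_invw q w : trav (dest q w) (invw w) = rev (trav q w).
Proof.
elim: w q => //= l w IH q; rewrite invw_cons dest_cons -cats1 trav_cat IH.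
by rewrite dest_invw /= edge_invl rev_cons cats1.
Qed.

Lemma reads_cat E q u w : reads E q (u ++ w) = reads E q u && reads E (dest q u) w.
Proof. by rewrite /reads trav_cat all_cat. Qed.

Lemma reads_cons E q l w :
  reads E q (l :: w) = (edge q l \in E) && reads E (step q l) w.
Proof. by []. Qed.

Lemma reads_rcons E q l w :
  reads E q (rcons w l) = reads E q w && (edge (dest q w) l \in E).
Proof. by rewrite -cats1 reads_cat reads_cons andbT. Qed.

Lemma reads_invw E q w : reads E (dest q w) (invw w) = reads E q w.
Proof. by rewrite /reads trav_invw all_rev. Qed.

Lemma reads_push E q l w : reads E q (l :: w) -> reads E q (push l w).
Proof.
case: w => [//|m w] /=; case: eqP => // ->.
by rewrite !reads_cons step_invl => /and3P[].
Qed.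

Lemma reads_reduce E q w : reads E q w -> reads E q (reduce w).
Proof.
elim: w q => //= l w IH q; rewrite reads_cons => /andP[el /IH rw].
by apply: reads_push; rewrite reads_cons el.
Qed.

Lemma reads_sub E E' q w : {subset E <= E'} -> reads E q w -> reads E' q w.
Proof. by move=> EE'; apply: sub_all => e /EE'. Qed.

(* For D the edges outside a spanning tree, trace D q0 maps a word for the
   Schreier generator of e in D to the single letter e; as it commutes with
   free reduction, the Schreier generators are free. *)
Fixpoint trace D q w : seq (Q * F * bool) :=
  if w is l :: w' then
    (if edge q l \in D then [:: (edge q l, l.2)] else [::]) ++
    trace D (step q l) w'
  else [::].

Lemma trace_cat D q u w : trace D q (u ++ w) = trace D q u ++ trace D (dest q u) w.
Proof.
elim: u q => [|l u IH] q; first by rewrite dest_nil.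
by rewrite /= IH dest_cons catA.
Qed.

Lemma trace_invw D q w : trace D (dest q w) (invw w) = invw (trace D q w).
Proof.
elim: w q => //= l w IH q; rewrite invw_cons dest_cons -cats1 trace_cat IH.
by rewrite dest_invw /= edge_invl invw_cat; case: ifP.
Qed.

(** A cancelling pair of letters crosses one edge back and forth, so its trace is empty or again a
    cancelling pair. *)
Lemma trace_push D q l w :
  reduce (trace D q (push l w)) = reduce (trace D q (l :: w)).
Proof.
case: w => [//|m w] /=; case: eqP => // ->.
rewrite edge_invl step_invl; case: ifP => //= _.
by rewrite (@pushK _ (edge q l, l.2)) //; apply: reduce_reduced.
Qed.

Lemma trace_reduce D q w :
  reduce (trace D q (reduce w)) = reduce (trace D q w).
Proof.
elim: w q => //= l w IH q; rewrite trace_push /=.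
by rewrite /reduce !foldr_cat -!/(reduce _) IH.
Qed.

Lemma trace_notin D q w : all [predC D] (trav q w) -> trace D q w = [::].
Proof.
elim: w q => //= l w IH q /andP[/negbTE lD /IH ->]; by rewrite [_ \in _]lD.
Qed.

(** * Spanning trees and Schreier generators *)

Section Rooted.
Variables (X : set F) (q0 : Q) (E : seq (Q * F)).
Hypothesis uniqE : uniq E.
Hypothesis EX : forall e, e \in E -> X e.2.
Hypothesis Econn : forall e, e \in E ->
  exists2 w, reads E q0 w & dest q0 w = e.1.

Definition verts := undup (q0 :: [seq e.1 | e <- E] ++ [seq tgt e | e <- E]).

Lemma reads_word_on q w : reads E q w -> word_on X w.
Proof.
elim: w q => // l w IH q; rewrite reads_cons => /andP[/EX /= Xl /IH Xw] m.
by rewrite inE => /orP[/eqP ->|/Xw].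
Qed.

Lemma tgt_edge q l : tgt (edge q l) = if l.2 then step q l else q.
Proof. by case: l => x []; rewrite /tgt /edge /step /evl //= actVK. Qed.

Lemma src_edge q l : (edge q l).1 = if l.2 then q else step q l.
Proof. by case: l => x []. Qed.

Lemma vertsP v :
  v \in verts -> exists2 w, reads E q0 w & dest q0 w = v.
Proof.
rewrite mem_undup inE mem_cat => /or3P[/eqP ->|/mapP[e Ee ->]|/mapP[e Ee ->]].
- by exists [::] => //; rewrite dest_nil.
- exact: Econn.
- have [w rw de] := Econn Ee; exists (rcons w (e.2, true)).
    by rewrite reads_rcons rw de /edge /= -surjective_pairing.
  by rewrite dest_rcons de.
Qed.

(* p q spells the path from q0 to q in the tree with vertices V and edges T. *)
Definition tree (V : seq Q) T (p : Q -> seq (F * bool)) :=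
  [/\ [/\ uniq V, q0 \in V & {subset V <= verts}],
      [/\ uniq T, {subset T <= E} & forall e, e \in T ->
        (e.1 \in V) && (tgt e \in V)],
      size V = (size T).+1, p q0 = [::] &
      (forall q, q \in V -> reads T q0 (p q) /\ dest q0 (p q) = q) /\
      (forall e, e \in T -> ev id (p e.1) * e.2 = ev id (p (tgt e)))].

Lemma reads_exit (V : seq Q) q w : q \in V -> dest q w \notin V -> reads E q w ->
  exists q' l, [/\ q' \in V, edge q' l \in E & step q' l \notin V].
Proof.
elim: w q => [|l w IH] q Vq; first by rewrite dest_nil Vq.
rewrite dest_cons reads_cons => nV /andP[el rw].
case: (boolP (step q l \in V)) => [Vl|]; first exact: IH rw.
by exists q, l.
Qed.

(** A path from the root to a missing vertex leaves V at some step; the edge crossed there and its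
    far end are added to the tree. *)
Lemma tree_extend V T p v : tree V T p -> v \in verts -> v \notin V ->
  exists V' T' p', tree V' T' p' /\ size V' = (size V).+1.
Proof.
move=> [[uV q0V Vv] [uT TE TV] sV p0 [pV pT]] /vertsP[w rw <-] nV.
have [q [l [Vq Eq nVq]]] := reads_exit q0V nV rw.
set v' := step q l in nVq;
  set p' := fun r => if r == v' then rcons (p q) l else p r.
have p'V r : r \in V -> p' r = p r.
  by move=> Vr; rewrite /p'; case: eqP => // rv; rewrite -rv Vr in nVq.
have p'v : p' v' = rcons (p q) l by rewrite /p' eqxx.
have [rq dq] := pV _ Vq.
exists (v' :: V), (edge q l :: T), p'; split=> //; split; last 1 first.
- split=> [r|e].
    rewrite inE; case: (eqVneq r v') => [-> _|_ /= Vr]; last first.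
      rewrite p'V //; have [rr dr] := pV _ Vr; split=> //.
      by apply: reads_sub rr => e Te; rewrite inE Te orbT.
    rewrite p'v reads_rcons dest_rcons dq mem_head andbT; split=> //.
    by apply: reads_sub rq => e Te; rewrite inE Te orbT.
  rewrite inE; case: (eqVneq e (edge q l)) => [-> _|_ /= Te]; last first.
    by have /andP[e1 e2] := TV e Te; rewrite !p'V // pT.
  rewrite src_edge tgt_edge -/v' /edge /=; case: ifP => l2.
    by rewrite p'v p'V // ev_rcons /evl l2.
  by rewrite p'v p'V // ev_rcons /evl l2 mulgVK.
- split=> [||] /=.
  + by rewrite nVq.
  + by rewrite inE q0V orbT.
  + move=> r; rewrite inE => /orP[/eqP ->|/Vv //].
    rewrite mem_undup inE mem_cat; apply/orP; right.
    case l2: l.2; apply/orP; [right|left]; apply/mapP; exists (edge q l) => //.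
      by rewrite tgt_edge l2.
    by rewrite src_edge l2.
- split=> [|e|e] /=.
  + rewrite uT andbT; apply: contra nVq => /TV.
    by rewrite src_edge tgt_edge -/v'; case: ifP => _ /andP[].
  + by rewrite inE => /orP[/eqP ->|/TE].
  + rewrite !inE => /orP[/eqP ->|/TV /andP[-> ->]]; last by rewrite !orbT.
    by rewrite src_edge tgt_edge -/v'; case: ifP => _; rewrite eqxx Vq !orbT.
- by rewrite /= sV.
- by rewrite p'V.
Qed.

Lemma spanning_tree : exists T p, tree verts T p.
Proof.
have [V [T [p [tr sV]]]] : exists V T p, tree V T p /\ {subset verts <= V}.
  have : tree [:: q0] [::] (fun=> [::]).
    split=> //; first by split=> [||v]; rewrite ?mem_head // inE => /eqP ->;
      rewrite mem_undup mem_head.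
    by split=> // q; rewrite inE => /eqP ->; rewrite dest_nil.
  move: (@nil (Q * F)) [:: q0] (fun=> [::]) => T V p.
  (* Induction on the number of vertices that the tree still misses. *)
  have [n] := ubnP (size verts - size V).
  elim: n V T p => // n IH V T p; rewrite ltnS => le_n tr.
  have [[uV _ Vv] _ _ _ _] := tr.
  have [vV|/allPn[v vv nV]] := boolP (all [in V] verts).
    by exists V, T, p; split=> // v /(allP vV).
  have [V' [T' [p' [tr' sV']]]] := tree_extend tr vv nV.
  apply: IH tr'; rewrite sV'.
  have : size (v :: V) <= size verts.
    apply: uniq_leq_size; first by rewrite /= nV.
    by move=> r; rewrite inE => /orP[/eqP ->|/Vv].
  by move: le_n => /=; lia.
have [[uV q0V Vv] [uT TE TV] sz p0 [pV pT]] := tr.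
have szV : size V = size verts.
  by apply: perm_size; apply: uniq_perm => // [|v];
    [exact: undup_uniq|apply/idP/idP; [exact: Vv|exact: sV]].
exists T, p; split; rewrite -?szV //.
- by split=> //; [exact: undup_uniq|exact: Vv].
- by split=> // e /TV /andP[/Vv -> /Vv ->].
- by split=> // q /sV; apply: pV.
Qed.

Variables (G : set F) (H : set F).
Hypothesis basX : basis G X.
Hypothesis Hstab : H = [set g | act q0 g = q0].
Hypothesis Hreads : forall h, H h -> exists2 w, reads E q0 w & ev id w = h.

(** The basis consists of the Schreier generators of the edges outside a spanning tree. The tree has
    one edge fewer than vertices, which gives the size E - V + 1. *)
Lemma graph_basis : exists s : seq F,
  [/\ uniq s, basis H [set` s] & size s + size verts = (size E).+1].
Proof.
have [T [p [_ [uT TE TV] sz p0 [pV pT]]]] := spanning_tree.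
have vq0 : q0 \in verts by rewrite mem_undup mem_head.
have sE e : e \in E -> e.1 \in verts.
  by move=> Ee; rewrite mem_undup inE mem_cat map_f ?orbT.
have tE e : e \in E -> tgt e \in verts.
  by move=> Ee; rewrite mem_undup inE mem_cat (map_f tgt) ?orbT.
pose D := [seq e <- E | e \notin T].
have DE e : e \in D -> e \in E by rewrite mem_filter => /andP[].
(* The Schreier generator of [e]: along the tree to its source, across [e], and back along the tree
   to the root. *)
pose b e := ev id (p e.1) * e.2 * (ev id (p (tgt e)))^-1.
have sD : size D + size T = size E.
  rewrite /D size_filter addnC -(count_predC [in T] E); congr (_ + _).
  rewrite -size_filter; apply: perm_size; apply: uniq_perm => // [|e].
    exact: filter_uniq.
  by rewrite mem_filter; case: (boolP (e \in T)) => //= /TE ->.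
pose xp (l : Q * F * bool) : seq (F * bool) :=
  let w := p l.1.1 ++ (l.1.2, true) :: invw (p (tgt l.1)) in
  if l.2 then w else invw w.
have ev_xp (l : Q * F * bool) : ev id (xp l) = evl b l.
  case: l => e b'; rewrite /xp /evl /=; case: b';
    rewrite ?ev_invw ev_cat ev_cons ev_invw mulgA //.
have reads_p q : q \in verts -> reads E q0 (p q).
  by move=> /pV[rp _]; apply: reads_sub rp.
have dest_p q : q \in verts -> dest q0 (p q) = q by move=> /pV[].
have invp q : q \in verts -> reads E q (invw (p q)) /\ dest q (invw (p q)) = q0.
  by move=> vq; rewrite -{1 3}(dest_p _ vq) reads_invw dest_invw reads_p.
have dest_w e : e \in E -> dest q0 (p e.1 ++ (e.2, true) :: invw (p (tgt e))) = q0.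
  by move=> Ee; rewrite dest_cat dest_cons dest_p ?sE // (invp _ (tE _ Ee)).2.
have xp_loop (l : Q * F * bool) : l.1 \in E -> dest q0 (xp l) = q0.
  case: l => e [] /= Ee; rewrite /xp /= ?dest_w //.
  by rewrite -{1}(dest_w _ Ee) dest_invw.
have xp_reads (l : Q * F * bool) : l.1 \in E -> reads E q0 (xp l).
  case: l => e b' /= Ee;
    suff rw : reads E q0 (p e.1 ++ (e.2, true) :: invw (p (tgt e))).
    by case: b' => //; rewrite /xp /= -{1}(dest_w _ Ee) reads_invw.
  rewrite reads_cat reads_cons reads_p ?sE // dest_p ?sE // /edge /=.
  by rewrite -surjective_pairing Ee (invp _ (tE _ Ee)).1.
have traceT q : q \in verts -> trace D q0 (p q) = [::].
  move=> /pV[rp _]; apply: trace_notin; apply: sub_all rp => e /= Te.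
  by rewrite mem_filter Te.
have trace_xp (l : Q * F * bool) : l.1 \in D -> trace D q0 (xp l) = [:: l].
  case: l => e b' /= De; have Ee := DE e De.
  have trw : trace D q0 (p e.1 ++ (e.2, true) :: invw (p (tgt e))) = [:: (e, true)].
    rewrite trace_cat /= dest_p ?sE // traceT ?sE // /edge /=
      -surjective_pairing De.
    by rewrite -[step _ _](dest_p _ (tE _ Ee)) trace_invw traceT // tE.
  by case: b'; rewrite /xp //= -(dest_w _ Ee) trace_invw trw.
pose xpw (u : seq (Q * F * bool)) : seq (F * bool) := flatten [seq xp m | m <- u].
have ev_xpw (u : seq (Q * F * bool)) : ev id (xpw u) = ev b u.
  elim: u => [|l u IH]; first by rewrite !ev_nil.
  by rewrite /xpw /= ev_cat -/(xpw u) IH ev_xp ev_cons.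
have loop (u : seq (Q * F * bool)) : (forall m, m \in u -> m.1 \in E) ->
  reads E q0 (xpw u).
  elim: u => // l u IH uE; have El := uE l (mem_head _ _).
  rewrite /xpw /= reads_cat xp_reads // xp_loop //; apply: IH => m mu.
  by apply: uE; rewrite inE mu orbT.
have trace_xpw (u : seq (Q * F * bool)) : (forall m, m \in u -> m.1 \in D) ->
  trace D q0 (xpw u) = u.
  elim: u => // l u IH uD; have Dl := uD l (mem_head _ _).
  rewrite /xpw /= trace_cat trace_xp // xp_loop ?DE //= IH // => m mu.
  by apply: uD; rewrite inE mu orbT.
(* A word [u] of value 1 in the generators expands to a word over X that reduces to the empty word.
   Tracing recovers [u] from the expansion and commutes with reduction, so a reduced [u] is
   empty. *)
have free (u : seq (Q * F * bool)) : (forall m, m \in u -> m.1 \in D) ->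
  freely_reduced u -> u <> [::] ->
    ev b u <> 1.
  move=> uD redu un0 u1; apply: un0.
  have red0 : reduce (xpw u) = [::].
    apply: (basis_reduce basX); last by rewrite word_valE ev_xpw.
    by apply: (@reads_word_on q0); apply: loop => l /uD /DE.
  by rewrite -(reduce_id redu) -{1}(trace_xpw u uD) -trace_reduce red0.
exists [seq b e | e <- D]; split.
- rewrite map_inj_in_uniq ?filter_uniq //; exact: free_family_inj free.
- suff -> : H = generated [set` [seq b e | e <- D]] by exact: free_family_basis.
  set K := generated _; have subK : subgroup K by apply: subgroup_generated.
  have subH : subgroup H.
    rewrite Hstab; split=> [|x y /= Hx Hy]; first exact: act1.
    by rewrite actM Hx -{1}Hy actK.
  apply/seteqP; split; last first.
    apply: generated_min => // x /= /mapP[e /DE Ee ->].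
    by rewrite Hstab /= -[b e]/(evl b ((e, true) : Q * F * bool)) -ev_xp;
      apply: xp_loop.
  have bK e : e \in E -> K (b e).
    move=> Ee; case: (boolP (e \in T)) => Te.
      by rewrite /b pT // mulgV; apply: subgroup1.
    by apply: mem_generated; rewrite /= map_f // mem_filter Te.
  move=> h Hh; have [w rw wh] := Hreads Hh; rewrite -wh.
  (* Telescoping: inserting tree paths back to the root after every letter splits a path into
     Schreier generators and their inverses. *)
  have KP q u : q \in verts -> reads E q u ->
      dest q u \in verts /\ K (ev id (p q) * ev id u * (ev id (p (dest q u)))^-1).
    elim: u q => [|l u IH] q vq.
      by rewrite dest_nil ev_nil mulg1 mulgV; split=> //; apply: subgroup1.
    rewrite reads_cons dest_cons => /andP[el ru].
    have vl : step q l \in verts.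
      by have := sE _ el; have := tE _ el; rewrite src_edge tgt_edge; case: ifP.
    have [? Ku] := IH _ vl ru; split=> //.
    rewrite ev_cons; set z := ev id (p (step q l)) in Ku.
    set c := (ev id _)^-1 in Ku *.
    have -> : ev id (p q) * (evl id l * ev id u) * c =
        ev id (p q) * evl id l * z^-1 * (z * ev id u * c) by rewrite !mulgA mulgVK.
    apply: (subgroupM subK) => //; have := bK _ el.
    rewrite /b src_edge tgt_edge /= /z /evl; case: ifP => //= l2 /(subgroupV subK).
    by rewrite !invgM invgK mulgA.
  have dh : dest q0 w = q0 by move: Hh; rewrite -wh Hstab.
  have [_] := KP _ _ vq0 rw.
  by rewrite dh p0 ev_nil mul1g invg1 mulg1.
- by rewrite size_map sz addnS sD.
Qed.

End Rooted.

End SchreierGraph.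
(** * Counting vertices and edges of fiber products *)

Section Counting.

Definition deg (E V : eqType) (s : E -> V) (e : seq E) v :=
  count (fun a => s a == v) e.

Lemma sum_deg (E V : eqType) (s : E -> V) (e : seq E) (v : seq V) :
  uniq v -> {in e, forall a, s a \in v} -> \sum_(x <- v) deg s e x = size e.
Proof.
move=> uv; elim: e => [|a e IH] sv; first by rewrite big1.
rewrite /deg /= big_split /= IH => [|b eb]; last by apply: sv; rewrite inE eb orbT.
rewrite -[RHS]add1n; congr (_ + _);
  rewrite -(big_map _ predT (fun i : nat => i)) /=.
rewrite big_map -big_mkcond /= sum1_count (eq_count (a2 := pred1 (s a))).
  by rewrite count_uniq_mem // sv ?mem_head.
by move=> x; rewrite /= eq_sym.
Qed.

Lemma count_splitI (T : Type) (a b : pred T) s :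
  count a s = count (fun x => a x && b x) s + count (fun x => a x && ~~ b x) s.
Proof. by elim: s => //= x s ->; case: (a x); case: (b x) => /=; lia. Qed.

(** Used to compare degrees along a projection that is injective on the edges at a vertex. *)
Lemma count_le_inj (A B : eqType) (f : A -> B) (s : seq A) (t : seq B)
    (P : pred A) (P' : pred B) :
    uniq s -> (forall a, a \in s -> P a -> (f a \in t) && P' (f a)) ->
    (forall a b, a \in s -> b \in s -> P a -> P b -> f a = f b -> a = b) ->
  count P s <= count P' t.
Proof.
move=> us ft finj; rewrite -!size_filter -(size_map f); apply: uniq_leq_size.
  rewrite map_inj_in_uniq ?filter_uniq // => a b.
  by rewrite !mem_filter => /andP[Pa sa] /andP[Pb sb]; apply: finj.
by move=> _ /mapP[a + ->]; rewrite mem_filter andbC => /andP[sa Pa];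
  rewrite mem_filter andbC ft.
Qed.

Lemma leq_sum_subseq (T : eqType) (s t : seq T) (f : T -> nat) :
  uniq s -> uniq t -> {subset s <= t} -> \sum_(x <- s) f x <= \sum_(x <- t) f x.
Proof.
move=> us ut st; rewrite [leqRHS](bigID [in s]) /=.
rewrite -[X in _ <= X + _]big_filter;
  have /(perm_big _) -> : perm_eq [seq x <- t | x \in s] s.
  apply: uniq_perm; rewrite ?filter_uniq // => x; rewrite mem_filter.
  by case: (boolP (x \in s)) => // /st.
exact: leq_addr.
Qed.

(* Excess of the out-degree (resp. in-degree) of a vertex of out-degree a and
   in-degree b, arranged to be nonnegative and to sum to a + b - 2. *)
Definition excess a b := if a == 0 then 0 else if b == 0 then a - 2 else a - 1.

Lemma excess_sum a b : 2 <= a + b -> excess a b + excess b a + 2 = a + b.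
Proof. by rewrite /excess; case: eqP => ?; case: eqP => ?; lia. Qed.

(** If neither a nor b is 0, each direction obeys min(n + 1, k + 1) <= 1 + n k. If one of them is 0,
    that direction contributes nothing, and the whole constant 2 serves the other. *)
Lemma vertex_bound a b c d x y : 2 <= a + b -> 0 < c -> 0 < d ->
  x <= a -> x <= c -> y <= b -> y <= d ->
  x + y <= 2 + (excess a b * (c - 1) + excess b a * (d - 1)).
Proof.
case: c d => [|c] [|d] // ab _ _ xa xc yb yd; rewrite !subn1 /=.
have key m n k : m <= n.+1 -> m <= k.+1 -> m <= 1 + n * k by case: n => [|n]; nia.
rewrite /excess; case: eqP => a0; case: eqP => b0; first by lia.
- have : y - 1 <= 1 + (b - 2) * d by apply: key; lia.
  lia.
- have : x - 1 <= 1 + (a - 2) * c by apply: key; lia.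
  lia.
- have : x <= 1 + (a - 1) * c by apply: key; lia.
  have : y <= 1 + (b - 1) * d by apply: key; lia.
  lia.
Qed.

(** * Euler characteristic of a graph immersed in two others *)

Variables (VH EH VK EK : eqType).
Variables (sH tH : EH -> VH) (sK tK : EK -> VK).

Definition pairmap (s : EH -> VH) (s' : EK -> VK) (d : EH * EK) := (s d.1, s' d.2).

Definition subgraph (E V : eqType) (s t : E -> V) (e : seq E) (v : seq V) :=
  [/\ uniq e, uniq v & forall a, a \in e -> (s a \in v) && (t a \in v)].

(* The two projections of the graph (d, w) are immersions into (e, v) and
   (e', v'). *)
Definition immersed (e : seq EH) (v : seq VH) (e' : seq EK) (v' : seq VK)
    (d : seq (EH * EK)) (w : seq (VH * VK)) :=
  [/\ subgraph (pairmap sH sK) (pairmap tH tK) d w,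
      forall a, a \in d -> (a.1 \in e) && (a.2 \in e'),
      forall x, x \in w -> (x.1 \in v) && (x.2 \in v') &
      forall a b, a \in d -> b \in d ->
        pairmap sH sK a = pairmap sH sK b \/ pairmap tH tK a = pairmap tH tK b ->
        a.1 = b.1 \/ a.2 = b.2 -> a = b].

Lemma deg_immersed e v e' v' d w x : immersed e v e' v' d w ->
  [/\ deg (pairmap sH sK) d x <= deg sH e x.1, deg (pairmap sH sK) d x <= deg
    sK e' x.2,
      deg (pairmap tH tK) d x <= deg tH e x.1
        & deg (pairmap tH tK) d x <= deg tK e' x.2].
Proof.
move=> [[ud _ _] de _ inj].
split; [apply: (count_le_inj (f := fst))|apply: (count_le_inj (f := snd))|
        apply: (count_le_inj (f := fst))|apply: (count_le_inj (f := snd))] => //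
  [a /de /andP[? ?] /eqP <-|a b da db /eqP ax /eqP bx ab
  |a /de /andP[? ?] /eqP <-|a b da db /eqP ax /eqP bx ab
  |a /de /andP[? ?] /eqP <-|a b da db /eqP ax /eqP bx ab
  |a /de /andP[? ?] /eqP <-|a b da db /eqP ax /eqP bx ab];
  by [apply/andP|apply: inj; rewrite ?ax ?bx; auto].
Qed.

Variables (e' : seq EK) (v' : seq VK).
Hypothesis K_graph : subgraph sK tK e' v'.
Hypothesis K_out : forall y, y \in v' -> 0 < deg sK e' y.
Hypothesis K_in : forall y, y \in v' -> 0 < deg tK e' y.

Lemma sum_deg_subn1 (s : EK -> VK) : {in e', forall a, s a \in v'} ->
  (forall y, y \in v' -> 0 < deg s e' y) ->
  \sum_(y <- v') (deg s e' y - 1) + size v' = size e'.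
Proof.
have [_ uv' _] := K_graph => sv' pos.
rewrite -(sum_deg uv' sv') -sum1_size -big_split /= !big_seq.
by apply: eq_bigr => y /pos; lia.
Qed.

(** The case without hair: [vertex_bound] is summed over [w], and the doubled inequality is halved
    at the end. *)
Lemma core_bound e v d w :
  subgraph sH tH e v -> immersed e v e' v' d w ->
  (forall x, x \in v -> 2 <= deg sH e x + deg tH e x) ->
  size v <= size e /\
  size d <= size w + (size e - size v) * (size e' - size v').
Proof.
move=> [ue uv ev] imm deg2; have [[ud uw dw] de wv _] := imm.
have [ue' uv' ev'] := K_graph.
set a := fun x => excess (deg sH e x) (deg tH e x).
set b := fun x => excess (deg tH e x) (deg sH e x).
have ab : \sum_(x <- v) a x + \sum_(x <- v) b x + (size v).*2 = (size e).*2.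
  rewrite -[RHS]addnn -{1}(sum_deg (s := sH) (e := e) uv) => [|z /ev /andP[] //].
  rewrite -(sum_deg (s := tH) (e := e) uv) => [|z /ev /andP[] //].
  rewrite -muln2 -sum1_size big_distrl -!big_split /= !big_seq.
  apply: eq_bigr => x /deg2; rewrite mul1n; exact: excess_sum.
have cK := sum_deg_subn1 (s := sK) (fun z zv => proj1 (andP (ev' z zv))) K_out.
have dK := sum_deg_subn1 (s := tK) (fun z zv => proj2 (andP (ev' z zv))) K_in.
split; first by lia.
pose r x := a x.1 * (deg sK e' x.2 - 1) + b x.1 * (deg tK e' x.2 - 1).
have le2 : (size d).*2 <= (size w).*2 + \sum_(x <- w) r x.
  rewrite -[leqLHS]addnn -{1}(sum_deg (s := pairmap sH sK) (e := d) uw) =>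
    [|z /dw /andP[] //].
  rewrite -(sum_deg (s := pairmap tH tK) (e := d) uw) => [|z /dw /andP[] //].
  rewrite -muln2 -sum1_size big_distrl -!big_split /= !big_seq.
  apply: leq_sum => x xw; have /andP[xv xv'] := wv x xw; rewrite mul1n.
  have [? ? ? ?] := deg_immersed x imm.
  by apply: vertex_bound; rewrite ?deg2 ?K_out ?K_in.
(* The terms are nonnegative, so the sum may be extended to all pairs of vertices, where it
   factors. *)
have le_all : \sum_(x <- w) r x <= \sum_(x <- [seq (i, j) | i <- v, j <- v']) r x.
  apply: leq_sum_subseq => //; first by apply: allpairs_uniq => // - [? ?] [? ?].
  by move=> [i j] /wv /= /andP[iv jv]; apply: allpairs_f.
have eq_all : \sum_(x <- [seq (i, j) | i <- v, j <- v']) r x =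
    (\sum_(x <- v) a x + \sum_(x <- v) b x) * (size e' - size v').
  rewrite big_allpairs mulnDl !big_distrl -big_split /=; apply: eq_bigr => i _.
  rewrite big_split /= -!big_distrr /=; congr (_ * _ + _ * _); lia.
by move: le_all; rewrite eq_all; nia.
Qed.

(** Induction on the number of vertices, trimming hair from the free end [p], the only vertex that
    may have degree 1. If it does, [p] and its edge are removed and its neighbour becomes the new
    free end. The graph above loses all [wp] vertices over [p] and at most [wp] edges. *)
Lemma positive_bound e v d w p :
  subgraph sH tH e v -> immersed e v e' v' d w ->
  p \in v -> 0 < deg sH e p + deg tH e p ->
  (forall x, x \in v -> x != p -> 2 <= deg sH e x + deg tH e x) ->
  size v <= size e /\
  size d <= size w + (size e - size v) * (size e' - size v').
Proof.
have [n] := ubnP (size v).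
elim: n e v d w p => // n IH e v d w p; rewrite ltnS => vn He imm pv degp deg2.
have [leaf|core] := leqP (deg sH e p + deg tH e p) 1; last first.
  by apply: core_bound => // x xv; case: (eqVneq x p) => [->//|]; apply: deg2.
have [ue uv ev] := He; have [[ud uw dw] de wv inj] := imm.
pose P := [pred a | (sH a != p) && (tH a != p)].
have [e0 He0] : exists e0, [seq a <- e | sH a == p] ++ [seq a <- e | tH a == p]
  = [:: e0].
  move: degp leaf; rewrite /deg -!size_filter -size_cat.
  by case: (_ ++ _) => [|e0 [|]] // _ _; exists e0.
have inc a : a \in e -> (sH a == p) || (tH a == p) -> a = e0.
  move=> ae ap; apply/eqP; rewrite -mem_seq1 -He0 mem_cat !mem_filter ae !andbT //.
have [e0e e0p] : e0 \in e /\ (sH e0 == p) || (tH e0 == p).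
  have := mem_head e0 [::]; rewrite -He0 mem_cat !mem_filter.
  by case/orP => /andP[-> ->]; rewrite ?orbT.
pose q := if sH e0 == p then tH e0 else sH e0.
have qv : q \in v by have /andP[] := ev _ e0e; rewrite /q; case: ifP.
(* A loop at [p] would count twice in the degree. *)
have qp : q != p.
  apply/negP => /eqP qp.
  have [s0 t0] : sH e0 = p /\ tH e0 = p.
    by move: e0p qp; rewrite /q; case: (sH e0 =P p) => //= ? /eqP.
  have : 0 < deg sH e p by rewrite -has_count; apply/hasP; exists e0; rewrite // s0.
  have : 0 < deg tH e p by rewrite -has_count; apply/hasP; exists e0; rewrite // t0.
  by lia.
have split_deg x : x != p ->
    deg sH e x + deg tH e x = deg sH (filter P e) x + deg tH (filter P e) x +
    (count (fun a => (sH a == x) && (tH a == p)) e +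
     count (fun a => (tH a == x) && (sH a == p)) e).
  move=> xp;
  have half (s t : EH -> VH) : (forall a, P a = (s a != p) && (t a != p)) ->
      deg s e x = deg s (filter P e) x + count (fun a =>
        (s a == x) && (t a == p)) e.
    move=> Pst;
      rewrite /deg count_filter addnC (count_splitI _ (fun a => t a == p)).
    congr (_ + _); apply: eq_count => a.
    rewrite -[RHS]/((s a == x) && P a) Pst; by case: eqP => //= ->; rewrite xp.
  by rewrite (half sH tH) // (half tH sH) => [|a];
    [rewrite addnACA|rewrite /= andbC].
(* Only the neighbour [q] loses degree, and at most 1. *)
have lost x : x \in v -> x != p ->
    count (fun a => (sH a == x) && (tH a == p)) e +
    count (fun a => (tH a == x) && (sH a == p)) e <= (x == q).
  move=> xv xp; case: (eqVneq x q) => xq.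
    apply: leq_trans leaf; rewrite addnC.
    by apply: leq_add; apply: sub_count => a /= /andP[].
  rewrite leqn0 addn_eq0; apply/andP; split; rewrite eqn0Ngt -has_count.
    apply/hasPn => a ae; apply/negP => /andP[/eqP sx tp].
    move: xq; rewrite -sx (inc a ae) ?tp ?orbT // /q;
      case: (sH e0 =P p) => [sp|]; last by rewrite eqxx.
    by rewrite -sx (inc a ae) ?tp ?orbT // sp eqxx in xp.
  apply/hasPn => a ae; apply/negP => /andP[/eqP tx sp].
  have ae0 := inc a ae; rewrite sp in ae0.
  by move: xq; rewrite -tx /q -ae0 // sp eqxx.
have size_v : size v = (size (filter (predC1 p) v)).+1.
  rewrite size_filter -(count_predC (pred1 p) v) count_uniq_mem // pv add1n;
    congr _.+1.
have size_e : size (filter P e) < size e.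
  rewrite size_filter -(count_predC P e) -[ltnLHS]addn0 ltn_add2l -has_count.
  by apply/hasP; exists e0 => //=; rewrite negb_and !negbK.
pose wp := count (fun x => x.1 == p) w.
have size_w : size w = size (filter (fun x => x.1 != p) w) + wp.
  by rewrite size_filter addnC -(count_predC (fun x => x.1 == p) w).
(* By the immersion property, an edge above is determined by its image in [e] and its end over
   [p]. *)
have fiber (s : EH -> VH) (s' : EK -> VK) :
    (forall a, a \in d -> pairmap s s' a \in w) ->
    (forall a b, a \in d -> b \in d -> pairmap s s' a = pairmap s s' b ->
       a.1 = b.1 -> a = b) ->
    count (fun a => s a.1 == p) d <= deg s e p * wp.
  move=> dsw injs;
    rewrite /deg /wp -!size_filter -(size_allpairs pair)
      -(size_map (fun a => (a.1, pairmap s s' a))).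
  apply: uniq_leq_size.
    rewrite map_inj_in_uniq ?filter_uniq // => a b; rewrite !mem_filter.
    by move=> /andP[_ da] /andP[_ db] [ab1 ss1 ss2]; apply: injs => //; congr pair.
  move=> _ /mapP[a + ->]; rewrite mem_filter => /andP[sp da].
  apply: allpairs_f; rewrite mem_filter /= sp /=; first by have /andP[] := de a da.
  exact: dsw.
have size_d : size d <= size (filter (fun a => P a.1) d) + wp.
  rewrite size_filter -(count_predC (fun a => P a.1) d) leq_add2l.
  apply: (@leq_trans (count (fun a => sH a.1 == p) d + count (fun a =>
    tH a.1 == p) d)).
    rewrite -count_predUI; apply: leq_trans (leq_addr _ _);
      apply: sub_count => a /=.
    by rewrite negb_and !negbK.
  apply: (@leq_trans ((deg sH e p + deg tH e p) * wp));
    last by rewrite -{2}[wp]mul1n leq_mul2r leaf orbT.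
  rewrite mulnDl; apply: leq_add; [apply: (fiber sH sK)|apply: (fiber tH tK)].
  - by move=> a /dw /andP[].
  - by move=> a b da db ss ab; apply: inj => //; [left|left].
  - by move=> a /dw /andP[].
  - by move=> a b da db ss ab; apply: inj => //; [right|left].
have [||||||] := IH (filter P e) (filter (predC1 p) v) (filter (fun a => P a.1) d)
    (filter (fun x => x.1 != p) w) q.
- by rewrite -size_v.
- split; rewrite ?filter_uniq // => a;
    rewrite !mem_filter /= => /andP[/andP[-> ->]] /ev.
  by [].
- split.
  + split; rewrite ?filter_uniq // => a;
      rewrite !mem_filter /= => /andP[/andP[-> ->]] /dw.
    by [].
  + by move=> a; rewrite !mem_filter => /andP[-> /de].
  + by move=> x; rewrite !mem_filter => /andP[/= -> /wv].
  + by move=> a b; rewrite !mem_filter => /andP[_ da] /andP[_ db]; apply: inj.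
- by rewrite mem_filter /= qp.
- rewrite -(leq_add2r 1); apply: leq_trans (deg2 q qv qp) _.
  by rewrite split_deg // leq_add2l; apply: leq_trans (lost q qv qp) _;
    rewrite eqxx.
- move=> x; rewrite mem_filter => /andP[/= xp xv] xq; have := lost x xv xp.
  have := deg2 x xv xp; rewrite (split_deg x xp) (negbTE xq) leqn0.
  by move=> /[swap] /eqP ->; rewrite addn0.
- move=> le_ve le_d; clear - size_v size_e size_w size_d le_ve le_d.
  split; first by rewrite size_v; apply: leq_ltn_trans size_e.
  apply: leq_trans size_d _; rewrite size_w addnAC leq_add2r.
  apply: leq_trans le_d _; rewrite leq_add2l leq_mul2r; apply/orP; right.
  by rewrite size_v; lia.
Qed.

End Counting.
(** * Graphs spanned by loops *)

Section LoopGraph.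
Local Open Scope group_scope.
Local Open Scope classical_set_scope.
Variables (F : groupType) (Q : eqType) (act : Q -> F -> Q).
Hypothesis act1 : forall q, act q 1 = q.
Hypothesis actM : forall q g h, act q (g * h) = act (act q g) h.
Implicit Types (q v : Q) (e : Q * F) (l m : F * bool) (w : seq (F * bool)).

Lemma travP e q w : e \in trav act q w ->
  exists w1 l w2, w = w1 ++ l :: w2 /\ e = edge act (dest act q w1) l.
Proof.
elim: w q => //= l w IH q; rewrite inE => /orP[/eqP ->|/IH[w1 [m [w2 [-> ->]]]]].
  by exists [::], l, w; rewrite dest_nil.
by exists (l :: w1), m, w2; rewrite dest_cons.
Qed.

(** Distinct letters readable at [v] use distinct ends of edges; a loop at [v] counts once as
    outgoing and once as incoming. *)
Lemma deg_ge2 (E : seq (Q * F)) v l m : l != m ->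
  edge act v l \in E -> edge act v m \in E ->
  2 <= deg fst E v + deg (tgt act) E v.
Proof.
have out x : (v, x) \in E -> 0 < deg fst E v.
  by move=> Ex; rewrite -has_count; apply/hasP; exists (v, x) => //=.
have inn x : (act v x^-1, x) \in E -> 0 < deg (tgt act) E v.
  by move=> Ex; rewrite -has_count; apply/hasP; exists (act v x^-1, x);
    rewrite /tgt //= actVK.
have two (T : eqType) (a : pred T) (s : seq T) x y : x != y -> x \in s -> y \in s ->
    a x -> a y -> 2 <= count a s.
  move=> xy xs ys ax ay; rewrite -size_filter.
  apply: (@uniq_leq_size _ [:: x; y]); first by rewrite /= inE xy.
  by move=> z; rewrite !inE => /orP[] /eqP ->; rewrite mem_filter ?ax ?ay.
case: l m => x [] [y []]; rewrite /edge /= => lm Ex Ey.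
- rewrite -[2]addn0; apply: leq_add => //; apply: (two _ _ _ _ _ _ Ex Ey);
    rewrite /= ?eqxx //.
  by apply: contra lm; rewrite !xpair_eqE eqxx andbT => /andP[_ ->].
- by rewrite -addn1; apply: leq_add; [apply: out Ex|apply: inn Ey].
- by rewrite -addn1; apply: leq_add; [apply: out Ey|apply: inn Ex].
- rewrite -[2]add0n; apply: leq_add => //; apply: (two _ _ _ _ _ _ Ex Ey).
  + by apply: contra lm; rewrite !xpair_eqE eqxx andbT => /andP[_ ->].
  + by rewrite /tgt /= actVK.
  + by rewrite /tgt /= actVK.
Qed.

Lemma subgraph_verts (E : seq (Q * F)) q : uniq E ->
  subgraph fst (tgt act) E (verts act q E).
Proof.
move=> uE; split; rewrite ?undup_uniq // => e Ee.
by rewrite !mem_undup !inE !mem_cat (map_f fst Ee) (map_f (tgt act) Ee) !orbT.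
Qed.

(** * The connected component of the root *)

Section Component.
Variables (q0 : Q) (E : seq (Q * F)).

Definition component :=
  [seq e <- E | `[< exists2 w, reads act E q0 w & dest act q0 w = e.1 >]].

(** The prefixes of [w] themselves witness that the edges crossed are connected to the root. *)
Lemma reads_component w : reads act E q0 w -> reads act component q0 w.
Proof.
elim/last_ind: w => // w l IH; rewrite !reads_rcons // => /andP[rw el].
rewrite IH //= mem_filter el andbT; apply/asboolP.
rewrite src_edge; case: ifP => l2; first by exists w.
by exists (rcons w l); rewrite ?dest_rcons // reads_rcons ?rw.
Qed.

Lemma component_conn e : e \in component ->
  exists2 w, reads act component q0 w & dest act q0 w = e.1.
Proof.
by rewrite mem_filter => /andP[/asboolP[w /reads_component ? ?] _]; exists w.
Qed.

End Component.

(** * The finite graph traced by a list of loops at the root *)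

Variables (q0 : Q) (W : seq (seq (F * bool))).
Hypothesis loopW : forall w, w \in W -> dest act q0 w = q0.

Definition loop_edges := undup (flatten [seq trav act q0 w | w <- W]).

Lemma loop_edgesP e : e \in loop_edges -> exists w1 l w2,
  w1 ++ l :: w2 \in W /\ e = edge act (dest act q0 w1) l.
Proof.
rewrite mem_undup => /flatten_mapP[w Ww /travP[w1 [l [w2 [wE ->]]]]].
by exists w1, l, w2; rewrite -wE.
Qed.

Lemma reads_loop w : w \in W -> reads act loop_edges q0 w.
Proof.
move=> Ww; apply/allP => e ew; rewrite /= mem_undup; apply/flatten_mapP.
by exists w.
Qed.

Lemma mem_loop_edges w1 l w2 : w1 ++ l :: w2 \in W ->
  edge act (dest act q0 w1) l \in loop_edges.
Proof. by move=> /reads_loop; rewrite reads_cat // reads_cons => /and3P[]. Qed.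

Lemma loop_edges_conn e : e \in loop_edges ->
  exists2 w, reads act loop_edges q0 w & dest act q0 w = e.1.
Proof.
move=> /loop_edgesP[w1 [l [w2 [/reads_loop rw ->]]]].
move: rw; rewrite -cat_rcons reads_cat // => /andP[rw _].
rewrite src_edge; case: ifP => l2.
  by exists w1 => //; move: rw; rewrite reads_rcons // => /andP[].
by exists (rcons w1 l); rewrite ?dest_rcons.
Qed.

(** The values of the loops at the root inside the graph form a subgroup containing the
    generators. *)
Lemma loop_edges_generated (h : F) :
  generated [set ev id w | w in [set` W]] h ->
  exists2 w, reads act loop_edges q0 w & ev id w = h.
Proof.
pose L := [set g | exists w,
  [/\ reads act loop_edges q0 w, dest act q0 w = q0 & ev id w = g]].
suff /[apply] [[w [? _ ?]]] :
  generated [set ev id w | w in [set` W]] `<=` L by exists w.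
apply: generated_min => [|_ [w /= Ww <-]]; last first.
  by exists w; split=> //; [exact: reads_loop|exact: loopW].
split; first by exists [::]; rewrite dest_nil // ev_nil.
move=> _ _ [u [ru du <-]] [w [rw dw <-]]; exists (u ++ invw w); split.
- by rewrite reads_cat // ru du -{1}dw reads_invw.
- by rewrite dest_cat // du -{1}dw dest_invw.
- by rewrite ev_cat ev_invw.
Qed.

Hypothesis W_neq0 : exists2 w, w \in W & w != [::].

Lemma verts_loop v : v \in verts act q0 loop_edges ->
  exists w1 w2, [/\ w1 ++ w2 \in W, w1 ++ w2 != [::] & v = dest act q0 w1].
Proof.
have [w Ww wn0] := W_neq0.
rewrite mem_undup inE mem_cat => /or3P[/eqP ->|/mapP[e Ee ->]|/mapP[e Ee ->]].
- by exists [::], w; rewrite dest_nil.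
- have [w1 [l [w2 [Ww1 ->]]]] := loop_edgesP Ee; rewrite src_edge; case: ifP => _.
    by exists w1, (l :: w2); split=> //; case: (w1).
  exists (rcons w1 l), w2; rewrite cat_rcons; split=> //; first by case: (w1).
  by rewrite dest_rcons.
- have [w1 [l [w2 [Ww1 ->]]]] := loop_edgesP Ee; rewrite tgt_edge //;
    case: ifP => _; last first.
    by exists w1, (l :: w2); split=> //; case: (w1).
  exists (rcons w1 l), w2; rewrite cat_rcons; split=> //; first by case: (w1).
  by rewrite dest_rcons.
Qed.

Lemma loop_root_deg : 0 < deg fst loop_edges q0 + deg (tgt act) loop_edges q0.
Proof.
have [[//|l w] Ww _] := W_neq0.
have := @mem_loop_edges [::] l w Ww; rewrite dest_nil // => El.
rewrite addn_gt0 -!has_count; apply/orP; case l2: l.2; [left|right];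
  apply/hasP; exists (edge act q0 l) => //=.
  by rewrite l2.
by rewrite tgt_edge // l2.
Qed.

Hypothesis redW : forall w, w \in W -> freely_reduced w.

(** A reduced loop that enters [v] by [l] and leaves by [m] has [m] distinct from [invl l], and both
    letters are readable at [v]. Only the root can fail to be interior to a loop. *)
Lemma loop_deg v : v \in verts act q0 loop_edges -> v != q0 ->
  2 <= deg fst loop_edges v + deg (tgt act) loop_edges v.
Proof.
move=> /verts_loop[w1 [w2 [Ww _ ->]]].
case: w2 Ww => [|m w2]; first by rewrite cats0 => /loopW ->; rewrite eqxx.
case/lastP: w1 => [|w1 l] Ww; first by rewrite dest_nil // eqxx.
move=> _; apply: (@deg_ge2 _ _ (invl l) m).
- have := redW Ww; rewrite cat_rcons; clear; elim: w1 => [|n w1 IH] /=.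
    by rewrite freely_reduced_cons eq_sym => /andP[].
  by move=> /freely_reduced_behead.
- rewrite dest_rcons // edge_invl //; apply: (@mem_loop_edges _ _ (m :: w2)).
  by rewrite -cat_rcons.
- exact: mem_loop_edges Ww.
Qed.

Hypothesis posW : forall w l, w \in W -> l \in w -> l.2.

(** A positive loop leaves each vertex it visits along an outgoing edge; at its end, the root, it
    can be started again. *)
Lemma loop_out_pos v : v \in verts act q0 loop_edges -> 0 < deg fst loop_edges v.
Proof.
have out w1 l w2 : w1 ++ l :: w2 \in W -> 0 < deg fst loop_edges (dest act q0 w1).
  move=> Ww; rewrite -has_count; apply/hasP; exists (edge act (dest act q0 w1) l).
    exact: mem_loop_edges Ww.
  by rewrite /= (posW Ww) // mem_cat mem_head orbT.
move=> /verts_loop[w1 [[|m w2] [Ww wn0 ->]]]; last exact: out Ww.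
rewrite cats0 in Ww wn0; rewrite loopW //; case: w1 Ww wn0 => [//|l w] Ww _.
by have := out [::] l w Ww; rewrite dest_nil.
Qed.

Lemma loop_in_pos v : v \in verts act q0 loop_edges ->
  0 < deg (tgt act) loop_edges v.
Proof.
have inn w1 l w2 : w1 ++ l :: w2 \in W ->
    0 < deg (tgt act) loop_edges (dest act q0 (rcons w1 l)).
  move=> Ww; rewrite -has_count; apply/hasP; exists (edge act (dest act q0 w1) l).
    exact: mem_loop_edges Ww.
  by rewrite /= tgt_edge // (posW Ww) ?dest_rcons // mem_cat mem_head orbT.
move=> /verts_loop[w1 [w2 [Ww wn0 ->]]].
case/lastP: w1 Ww wn0 => [|w1 l]; last by rewrite cat_rcons => /inn.
rewrite dest_nil //; case/lastP: w2 => [//|w2 l] /= Ww _.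
by have := inn w2 l [::]; rewrite cats1 (loopW Ww); apply.
Qed.

End LoopGraph.
(** * Intersections *)

Section Intersection.
Local Open Scope group_scope.
Local Open Scope classical_set_scope.
Variables (F : groupType).
Implicit Types (A H K X : set F) (g : F) (w : seq (F * bool)).

(** The right translate Ag, so that the orbit of H under this right action is the set of cosets Hg,
    with stabilizer H at the vertex H. *)
Definition translate A g : set F := [set y | A (y / g)].

Lemma translate1 A : translate A 1 = A.
Proof. by apply/seteqP; split=> y; rewrite /translate /= divg1. Qed.

Lemma translateM A g h : translate A (g * h) = translate (translate A g) h.
Proof. by apply/seteqP; split=> y; rewrite /translate /= invgM mulgA. Qed.

Lemma translate_stab H : subgroup H -> H = [set g | translate H g = H].
Proof.
move=> sH; apply/seteqP; split=> g /=; last first.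
  by move=> <-; rewrite /translate /= mulgV; apply: subgroup1.
move=> Hg; apply/seteqP; split=> y; rewrite /translate /= => Hy; last exact: sH.2.
by rewrite -[y](mulgVK g); apply: subgroupM.
Qed.

Definition translate2 (q : set F * set F) g := (translate q.1 g, translate q.2 g).

Lemma translate21 q : translate2 q 1 = q.
Proof. by case: q => A B; rewrite /translate2 !translate1. Qed.

Lemma translate2M q g h : translate2 q (g * h) = translate2 (translate2 q g) h.
Proof. by rewrite /translate2 !translateM. Qed.

Definition fiber_product (E E' : seq (set F * F)) : seq (set F * set F * F) :=
  [seq ((a.1, c.1), a.2) | a <- E, c <- [seq c <- E' | c.2 == a.2]].

Lemma mem_fiber_product E E' (q : set F * set F) g :
  ((q, g) \in fiber_product E E') = ((q.1, g) \in E) && ((q.2, g) \in E').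
Proof.
apply/allpairsPdep/andP => [[[A x] [[B y] []]]|[E1 E2]].
  by rewrite mem_filter /= => Ea /andP[/eqP -> Ec] [-> ->].
by exists (q.1, g), (q.2, g); rewrite mem_filter /= eqxx -surjective_pairing.
Qed.

Lemma reads_fiber_product E E' (q : set F * set F) w :
  reads translate2 (fiber_product E E') q w =
  reads translate E q.1 w && reads translate E' q.2 w.
Proof.
elim: w q => //= l w IH q; rewrite !reads_cons IH [edge _ q l]surjective_pairing.
by rewrite mem_fiber_product /edge; case: l.2; rewrite /= andbACA.
Qed.

(** Finitely many loops of a prescribed kind [R] suffice: [R] is later the reduced words with value
    in H, or reduced positive words. As H is nontrivial, one of the loops is nonempty. *)
Lemma loop_words H (R : set (seq (F * bool))) :
  H <> [set 1] ->
  finitely_generated H -> H = generated [set ev id w | w in R] ->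
  exists W : seq (seq (F * bool)),
    [/\ forall w, w \in W -> R w, H = generated [set ev id w | w in [set` W]] &
        exists2 w, w \in W & w != [::]].
Proof.
move=> Hn1 fgH HR; have [s sR Hs] := finitely_generated_sub fgH HR.
pose f x := xget [::] [set w | R w /\ ev id w = x].
have fP x : x \in s -> R (f x) /\ ev id (f x) = x.
  move=> xs; have [w Rw wx] := sR x xs; rewrite /f; case: xgetP => // /(_ w).
  by case.
have HW : H = generated [set ev id w | w in [set` [seq f x | x <- s]]].
  rewrite Hs; congr generated; apply/seteqP; split=> x /=.
    by move=> xs; exists (f x); [rewrite /= map_f|exact: (fP _ xs).2].
  by move=> [_ /= /mapP[y ys ->] <-]; rewrite (fP _ ys).2.
exists [seq f x | x <- s]; split=> //.
  by move=> _ /mapP[x xs ->]; exact: (fP _ xs).1.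
apply: contrapT => noW; apply: Hn1; apply/seteqP; split; last first.
  by move=> _ ->; rewrite HR; apply: subgroup1; exact: subgroup_generated.
rewrite HW; apply: generated_min => [|_ [w /= Ww <-]].
  by split=> // x y /= -> ->; rewrite mulgV.
rewrite /=; case: (eqVneq w [::]) => [->|wn0]; first by rewrite ev_nil.
by case: noW; exists w.
Qed.

(** * The graph of a finitely generated subgroup *)

Section Graph.
Variables (X H : set F) (W : seq (seq (F * bool))).
Hypothesis basisX : basis setT X.
Hypothesis subH : subgroup H.
Hypothesis WX : forall w, w \in W -> word_on X w.
Hypothesis HW : H = generated [set ev id w | w in [set` W]].

Let E := loop_edges translate H W.

Lemma word_loop w : w \in W -> dest translate H w = H.
Proof.
move=> Ww; have : H (ev id w) by rewrite HW; apply: mem_generated; exists w.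
by rewrite {1}(translate_stab subH).
Qed.

Lemma loop_edges_basis e : e \in E -> X e.2.
Proof.
move=> /(loop_edgesP translate1 translateM)[w1 [l [w2 [Ww ->]]]].
by apply: (WX Ww); rewrite mem_cat mem_head orbT.
Qed.

Lemma rank_loop_graph : exists n,
  rank H = (n%:Z)%:E%E /\ n + size (verts translate H E) = (size E).+1.
Proof.
have conn := @loop_edges_conn _ _ _ translate1 translateM H W.
have [|s [us bas sz]] := graph_basis translate1 translateM (undup_uniq _)
  loop_edges_basis conn basisX (translate_stab subH).
  move=> h; rewrite {1}HW; apply: (loop_edges_generated translate1 translateM).
  exact: word_loop.
by exists (size s); rewrite (rankE us bas).
Qed.

End Graph.

Lemma generated_reduced_words X H : basis setT X -> subgroup H ->
  H = generated [set ev id w | w in [set w | [/\ word_on X w, freely_reduced w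
    & H (ev id w)]]].
Proof.
move=> [XT _] sH; apply/seteqP; split; last first.
  by apply: generated_min => // _ [w /= [_ _ ?] <-].
move=> h Hh; apply: mem_generated; have : [set: F] h by [].
rewrite XT => /generatedP[w Xw wh]; exists (reduce w); last by rewrite ev_reduce.
split; first by move=> l /mem_reduce /Xw.
- exact: reduce_reduced.
- by rewrite ev_reduce -word_valE wh.
Qed.

(** Assembles the graphs of H, K and the intersection, turns ranks into edge and vertex counts, and
    applies [positive_bound] with H as the root that may carry hair. *)
Lemma positive_rank_bound X H K : basis setT X ->
  subgroup H -> subgroup K -> finitely_generated H -> finitely_generated K ->
  H <> [set 1] -> K <> [set 1] -> positively_generated X K ->
  (rank (H `&` K) - 1 <= (rank H - 1) * (rank K - 1))%E.
Proof.
move=> basX sH sK fgH fgK H1 K1 [P Ppos KP].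
have [WH [WHR HW WH0]] := loop_words H1 fgH (generated_reduced_words basX sH).
have [|WK [WKR KW WK0]] := loop_words (R := [set w | [/\ word_on X w,
    freely_reduced w, forall l, l \in w -> l.2 & P (ev id w)]]) K1 fgK.
  rewrite KP; congr generated; apply/seteqP; split;
    last by move=> _ [w [_ _ _ ?] <-].
  by move=> g Pg; have [w [Xw rw wg] posw] := Ppos g Pg; exists w => //;
    split=> //; rewrite -word_valE wg.
have WHX w : w \in WH -> word_on X w by move=> /WHR[].
have WKX w : w \in WK -> word_on X w by move=> /WKR[].
have [nH [rkH szH]] := rank_loop_graph basX sH WHX HW.
have [nK [rkK szK]] := rank_loop_graph basX sK WKX KW.
have dH := word_loop sH HW; have dK := word_loop sK KW.
have eHX := loop_edges_basis (H := H) WHX;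
  have eKX := loop_edges_basis (H := K) WKX.
have rootH := loop_root_deg translate1 translateM H WH0.
have degH := loop_deg translate1 translateM dH WH0 (fun w ww =>
  let: And3 _ r _ := WHR w ww in r).
have posK w l : w \in WK -> l \in w -> l.2 by move=> /WKR[_ _ + _]; apply.
have outK := loop_out_pos translate1 translateM dK WK0 posK.
have inK := loop_in_pos translate1 translateM dK WK0 posK.
have readsH := loop_edges_generated translate1 translateM dH.
have readsK := loop_edges_generated translate1 translateM dK.
rewrite -HW in readsH; rewrite -KW in readsK.
have uH : uniq (loop_edges translate H WH) by apply: undup_uniq.
have uK : uniq (loop_edges translate K WK) by apply: undup_uniq.
move: (loop_edges translate H WH) (loop_edges translate K WK) => eH eK in
  szH szK eHX eKX rootH degH outK inK readsH readsK uH uK.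
pose e0 := fiber_product eH eK.
pose e := component translate2 (H, K) e0.
have u0 : uniq e0.
  apply: allpairs_uniq_dep => // [a _|]; first by rewrite filter_uniq.
  move=> [[A x] [B y]] [[A' x'] [B' y']] /allpairsPdep[[C z] [[D t] [_ + [-> ->
    -> ->]]]].
  rewrite mem_filter /= => /andP[/eqP -> _].
  move=> /allpairsPdep[[C' z'] [[D' t'] [_ + [-> -> -> ->]]]].
  by rewrite mem_filter /= => /andP[/eqP -> _] [-> -> ->].
have ue : uniq e by rewrite filter_uniq.
have eHK c : c \in e -> ((c.1.1, c.2) \in eH) && ((c.1.2, c.2) \in eK).
  rewrite mem_filter => /andP[_].
  by rewrite {1}[c]surjective_pairing mem_fiber_product.
have stabHK : H `&` K = [set g | translate2 (H, K) g = (H, K)].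
  rewrite {1}(translate_stab sH) {1}(translate_stab sK).
  apply/seteqP; split=> g /=; rewrite /translate2 /=; first by move=> [-> ->].
  by move=> [? ?].
have eX c : c \in e -> X c.2 by move=> /eHK /andP[/eHX].
(* The paths for [h] in the two graphs may differ, but their reduced forms agree by freeness, and
   this common word is read in the fiber product. *)
have readsHK h : (H `&` K) h ->
  exists2 w, reads translate2 e (H, K) w & ev id w = h.
  move=> [/readsH[u ru uh] /readsK[w rw wh]]; exists (reduce u);
    last by rewrite ev_reduce.
  apply: (reads_component translate21 translate2M); rewrite reads_fiber_product /=.
  apply/andP; split; first exact: (reads_reduce translate1 translateM).
  rewrite (basis_reduce_inj basX (reads_word_on eHX ru) (reads_word_on eKX rw)).
    exact: (reads_reduce translate1 translateM).
  by rewrite !word_valE uh wh.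
have [s [us bas sz]] := graph_basis translate21 translate2M ue eX
  (component_conn translate21 translate2M (E := e0)) basX stabHK readsHK.
(* An edge of the fiber product rewritten as the pair of its projections, the form used in the
   counting. *)
pose d := [seq ((c.1.1, c.2), (c.1.2, c.2)) | c <- e].
have dinj : injective (fun c : set F * set F * F => ((c.1.1, c.2), (c.1.2, c.2))).
  by move=> [[? ?] ?] [[? ?] ?] /= [-> -> ->].
have trI x y g : translate x g = translate y g -> x = y.
  by move=> /(congr1 (translate^~ g^-1)); rewrite -!translateM mulgV !translate1.
have imm : immersed fst (tgt translate) fst (tgt translate)
    eH (verts translate H eH) eK (verts translate K eK) d (verts translate2 (H,
      K) e).
  have [_ uv ve] := subgraph_verts translate2 (H, K) ue.
  have [_ _ vH] := subgraph_verts translate H uH.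
  have [_ _ vK] := subgraph_verts translate K uK.
  split.
  - split=> // [|_ /mapP[[[A B] g] ce ->]]; first by rewrite map_inj_uniq.
    exact: ve ce.
  - by move=> _ /mapP[c ce ->]; apply: eHK.
  - move=> x; rewrite mem_undup inE mem_cat.
    case/or3P => [/eqP ->|/mapP[c /eHK /andP[cH cK] ->]|/mapP[c /eHK /andP[cH
      cK] ->]].
    + by rewrite !mem_undup !mem_head.
    + by have /andP[-> _] := vH _ cH; have /andP[-> _] := vK _ cK.
    + by have /andP[_ /= +] := vH _ cH; have /andP[_ /= +] := vK _ cK => -> ->.
  (* A common projection forces equal labels; a label and either end determine an edge, as
     translation is injective. *)
  - move=> _ _ /mapP[[[A B] g] _ ->] /mapP[[[A' B'] g'] _ ->].
    rewrite /pairmap /tgt /= => st gg.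
    have {}gg : g = g' by case: gg => [[_ ->]|[_ ->]].
    rewrite gg in st *; case: st => [[-> ->] //|[/trI -> /trI ->] //].
have vH0 : H \in verts translate H eH by rewrite mem_undup mem_head.
have [le_vH le_d] := positive_bound (subgraph_verts translate K uK) outK inK
  (subgraph_verts translate H uH) imm vH0 rootH degH.
(* With [le_vH], this makes the truncated differences E - V exact, so that they equal rank - 1 as
   integers. *)
have pos_vK : size (verts translate K eK) <= size eK.
  have [_ uv ve] := subgraph_verts translate K uK.
  rewrite -(sum_deg (s := fst) (e := eK) uv) => [|c /ve /andP[] //].
  by rewrite -sum1_size big_seq [leqRHS]big_seq; apply: leq_sum => y /outK.
rewrite (rankE us bas) rkH rkK size_map in le_d *.
rewrite -!EFinB -EFinM lee_fin.
set A := size (verts _ H _) in szH le_vH le_d;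
  set B := size (verts _ K _) in szK le_d pos_vK.
set C := size (verts _ _ _) in sz le_d.
have -> : (nH%:Z - 1 = (size eH - A)%:Z)%R by clear - szH le_vH; lia.
have -> : (nK%:Z - 1 = (size eK - B)%:Z)%R by clear - szK pos_vK; lia.
rewrite -PoszM; move: (_ * _)%N (size e) le_d sz; clear => m n; lia.
Qed.

End Intersection.

(** Nontriviality of H and K is the usual convention for this inequality: for trivial H it would
    read -1 <= 1 - rank K, which fails once K has rank at least 3. The two positive cases are
    exchanged by symmetry. *)
Theorem theorem3p9 (F : groupType) (X : set F) (H K : set F)
    (basisX : basis setT X)
    (subgroupH : subgroup H) (subgroupK : subgroup K)
    (fgH : finitely_generated H) (fgK : finitely_generated K)
    (ntH : H <> [set 1%g]%classic) (ntK : K <> [set 1%g]%classic)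
    (posHK : positively_generated X H \/ positively_generated X K) :
  (rank (H `&` K)%classic - 1 <= (rank H - 1) * (rank K - 1))%E.
Proof.
case: posHK => [posH|posK]; last exact: positive_rank_bound posK.
by rewrite setIC muleC; apply: positive_rank_bound posH.
Qed.
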